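(* Let $B$ be an abelian group equipped with an infinite family of group homomorphisms $r_v\colon B\to B_v$ (indexed by primes $v$ of a number field $F$) into finite abelian groups $B_v$, satisfying Assumptions (A1) and (A2) described in the context. Let $P,Q\in B$ be points of infinite order. Then the following are equivalent: (i) for all but finitely many $v$ there exist coprime integers $x,y$ and a point $T\in B_{\mathrm{tors}}$ such that $r_v(x^2P+y^2Q)=r_v(T)$; (ii) there exist coprime integers $x,y$ and a point $T\in B_{\mathrm{tors}}$ such that $x^2P+y^2Q=T$.
   Context: Setting: $F$ is a number field, $B$ an abelian group, and $r_v\colon B\to B_v$ an infinite family of group homomorphisms indexed by primes $v$ of $F$, with each $B_v$ a finite abelian group. $B_{\mathrm{tors}}$ denotes the torsion subgroup of $B$. For $P\in B$, $\mathrm{ord}_v P$ denotes the order of $r_v(P)$ in $B_v$. For a prime $l$ and positive integer $k$, $l^k\parallel n$ means $l^k\mid n$ and $l^{k+1}\nmid n$. Assumption (A1): for every prime number $l$, every sequence $(k_1,\dots,k_m)$ of nonnegative integers, and every points $P_1,\dots,P_m\in B$ linearly independent over $\mathbb{Z}$, there is a set of primes $v$ of $F$ of positive density such that for each $i$, $l^{k_i}\parallel \mathrm{ord}_v P_i$ if $k_i>0$ and $l\nmid \mathrm{ord}_v P_i$ if $k_i=0$. Assumption (A2): for all but finitely many $v$ the restriction of $r_v$ to $B_{\mathrm{tors}}$ is injective. (Examples: $S$-unit groups of a number field, Mordell–Weil groups $A(F)$ of abelian varieties with $\mathrm{End}_{\bar F}(A)=\mathbb{Z}$, odd $K$-groups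 $K_{2n+1}(F)$, $n>0$, with reduction maps.) *)

(* Defs.v *)
From HB Require Import structures.
From mathcomp Require Import all_boot all_order all_fingroup all_algebra all_field.
From Stdlib Require List.
Set Implicit Arguments.
Unset Strict Implicit.
Unset Printing Implicit Defensive.
Import GRing.Theory Num.Theory.
Local Open Scope ring_scope.

Definition alg_int (F : fieldExtType rat) (x : F) : Prop :=
  exists p : {poly int}, p \is monic /\ root (map_poly (fun z : int => z%:~R : F) p) x.

Definition is_nfprime (F : fieldExtType rat) (p : F -> Prop) : Prop :=
  (forall x, p x -> alg_int x) /\
  p 0 /\
  (forall x y, p x -> p y -> p (x + y)) /\
  (forall a x, alg_int a -> p x -> p (a * x)) /\
  ~ p 1 /\
  (exists x, p x /\ x <> 0) /\
  (forall a b, alg_int a -> alg_int b -> p (a * b) -> p a \/ p b).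

Definition nfprime (F : fieldExtType rat) := {p : F -> Prop | is_nfprime p}.

(* has_norm v n : the residue ring O_F / v has exactly n elements
   (n = N(v), the absolute norm of v). *)
Definition has_norm (F : fieldExtType rat) (v : nfprime F) (n : nat) : Prop :=
  exists s : seq F, [/\ size s = n,
    (forall i, (i < n)%N -> alg_int (nth 0 s i)),
    (forall i j, (i < n)%N -> (j < n)%N -> i <> j -> ~ proj1_sig v (nth 0 s i - nth 0 s j)) &
    (forall x, alg_int x -> exists2 i, (i < n)%N & proj1_sig v (x - nth 0 s i))].

Definition prime_count (F : fieldExtType rat) (S : nfprime F -> Prop) (X n : nat) : Prop :=
  exists l : list (nfprime F), [/\ List.NoDup l, length l = n &
    forall v, List.In v l <-> (S v /\ exists2 m, (m <= X)%N & has_norm v m)].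

Definition density_ratio (nS nAll : nat) : rat := (nS%:R / nAll%:R)%R.

(* S has a (natural) density, and it is positive: the ratios
   #{v in S : N v <= X} / #{v : N v <= X} form a Cauchy sequence (so they
   converge to a real number) which is eventually bounded below by some c > 0. *)
Definition pos_density (F : fieldExtType rat) (S : nfprime F -> Prop) : Prop :=
  (forall eps : rat, 0 < eps -> exists X0 : nat, forall X Y nX mX nY mY,
     (X0 <= X)%N -> (X0 <= Y)%N ->
     prime_count S X nX -> prime_count (fun _ : nfprime F => True) X mX ->
     prime_count S Y nY -> prime_count (fun _ : nfprime F => True) Y mY ->
     `|density_ratio nX mX - density_ratio nY mY| < eps)
  /\
  (exists2 c : rat, 0 < c & exists X0 : nat, forall X nX mX,
     (X0 <= X)%N -> prime_count S X nX -> prime_count (fun _ : nfprime F => True) X mX ->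
     c <= density_ratio nX mX).

Definition almost_all (F : fieldExtType rat) (Pr : nfprime F -> Prop) : Prop :=
  exists l : list (nfprime F), forall v, ~ List.In v l -> Pr v.

Definition torsion (B : zmodType) (P : B) : Prop := exists2 n : nat, (0 < n)%N & P *+ n = 0.

Definition ord_v (F : fieldExtType rat) (B : zmodType) (Bv : nfprime F -> finZmodType)
  (r : forall v, {additive B -> Bv v}) (v : nfprime F) (P : B) : nat :=
  #[r v P]%g.

Definition assumptionA1 (F : fieldExtType rat) (B : zmodType) (Bv : nfprime F -> finZmodType)
  (r : forall v, {additive B -> Bv v}) : Prop :=
  forall (l : nat), prime l -> forall (m : nat) (k : 'I_m -> nat) (P : 'I_m -> B),
    (forall a : 'I_m -> int, \sum_(i < m) P i *~ a i = 0 -> forall i, a i = 0) ->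
    exists S : nfprime F -> Prop, pos_density S /\
      forall v, S v -> forall i : 'I_m,
        if (0 < k i)%N then (l ^ k i %| ord_v r v (P i))%N /\ ~~ (l ^ (k i).+1 %| ord_v r v (P i))%N
        else ~~ (l %| ord_v r v (P i))%N.

Definition assumptionA2 (F : fieldExtType rat) (B : zmodType) (Bv : nfprime F -> finZmodType)
  (r : forall v, {additive B -> Bv v}) : Prop :=
  almost_all (fun v => forall T1 T2 : B, torsion T1 -> torsion T2 -> r v T1 = r v T2 -> T1 = T2).

(* Main.v *)
Require Import Defs.
From HB Require Import structures.
From mathcomp Require Import all_boot all_order all_fingroup all_algebra all_field.
From mathcomp Require Import boolp.
From mathcomp Require Import zify ring.
From Stdlib Require List.
Set Implicit Arguments.
Unset Strict Implicit.
Unset Printing Implicit Defensive.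
Import Order.TTheory GRing.Theory Num.Theory.
Local Open Scope ring_scope.

(* A set of positive density is not contained in a finite set of primes, as the
   primes of bounded norm are finite in number while there is one above every
   rational prime; so (A1) can be applied away from finitely many primes.

   If [P] and [Q] are independent, prescribe at [l = 2] that [P + 2Q] has odd
   order while the order of [Q] is very divisible by 2; then [x^2 P + y^2 Q]
   torsion forces [y^2 = 2 x^2] modulo 4, against coprimality.  If they are
   dependent, then up to torsion [P = m R] and [Q = n R] with [m], [n] coprime,
   and prescribing the order of [R] shows that [m x^2 + n y^2 = 0] is solvable
   in coprime integers modulo every prime power.  At the primes dividing [m n]
   this makes [|m|] and [|n|] squares, and modulo powers of 2 it makes their
   signs opposite, so the equation has a coprime integral solution.

   All torsion is killed by one integer, because by (A2) it embeds in some [B_v]. *)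

(** * Integer arithmetic of the diagonal equation [m x^2 + n y^2 = 0] *)

Lemma square_even_logn (n : nat) :
  (0 < n)%N -> (forall p, prime p -> ~~ odd (logn p n)) -> exists s, n = (s ^ 2)%N.
Proof.
move=> n_gt0 evn; exists (\prod_(p <- primes n) p ^ (logn p n)./2)%N.
rewrite {1}(prod_prime_decomp n_gt0) prime_decompE big_map /= -mulnn -big_split /=.
apply: eq_big_seq => p; rewrite mem_primes => /and3P[p_pr _ _].
by rewrite -expnD addnn even_halfK ?evn.
Qed.

Lemma odd_pfactor_dvd_square (p e y : nat) :
  prime p -> odd e -> (p ^ e %| y ^ 2)%N -> (p ^ e.+1 %| y ^ 2)%N.
Proof.
move=> p_pr odd_e; have [-> //|y_gt0] := posnP y.
rewrite !pfactor_dvdn ?expn_gt0 ?y_gt0 // lognX leq_eqVlt => /orP[/eqP e_eq|//].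
by rewrite e_eq oddM in odd_e.
Qed.

(** Squares are 0 or 1 modulo 4, so a sum of two squares divisible by 4 has both terms even; halving
    [a] and [b] is a descent on [k]. *)
Lemma pow2_dvd_sum_squares (k a b : nat) :
  (2 ^ k.*2 %| a ^ 2 + b ^ 2)%N -> (2 ^ k %| a)%N.
Proof.
elim: k a b => [|k IHk] a b; first by rewrite dvd1n.
rewrite doubleS (expnS 2 _.+1) (expnS 2 k.*2) mulnA => dvd4.
have /dvdnP[c c_eq] : (2 * 2 %| a ^ 2 + b ^ 2)%N by apply: dvdn_trans dvd4; apply: dvdn_mulr.
have [a_even b_even] : ~~ odd a /\ ~~ odd b.
  have := odd_double_half a; have := odd_double_half b.
  by case: (odd a); case: (odd b) => // aE bE; split=> //; exfalso; nia.
have a2 : a = (2 * a./2)%N by rewrite mul2n even_halfK.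
have b2 : b = (2 * b./2)%N by rewrite mul2n even_halfK.
rewrite a2 expnS dvdn_pmul2l //; apply: (IHk _ b./2).
by move: dvd4; rewrite a2 b2 !expnMn -mulnDr dvdn_pmul2l // -a2 -b2.
Qed.

(** Suppose the valuation [e] of [m] is odd, so that [l] is prime to [n]. A relation modulo
    [l^(e+1)] gives [l^e | y^2], hence [l^(e+1) | y^2] by parity. Then [l] divides [y] and not [x],
    and the relation leaves [l^(e+1) | m]. *)
Lemma even_logn_of_local_solutions (m n : int) (l : nat) :
  m != 0 -> coprimez m n -> prime l ->
  (forall k, exists x y : int,
     coprimez x y /\ ((l ^ k)%N%:Z %| x ^+ 2 * m + y ^+ 2 * n)%Z) ->
  ~~ odd (logn l `|m|).
Proof.
move=> m_neq0 cop l_pr loc; apply/negP => odd_e.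
set e := logn l `|m| in odd_e; have [x [y [cop_xy]]] := loc e.+1.
have m_gt0 : (0 < `|m|)%N by rewrite absz_gt0.
have e_gt0 : (0 < e)%N by case: (e) odd_e.
have dvd_m : (l ^ e %| `|m|)%N by rewrite pfactor_dvdn.
have l_m : (l %| `|m|)%N by apply: dvdn_trans dvd_m; rewrite dvdn_exp.
have cop_ln : coprime l `|n|.
  by move: cop; rewrite coprimezE; apply: coprime_dvdl.
have dvd_y (i : nat) : (l ^ i %| `|(x ^+ 2 * m + y ^+ 2 * n)%R|)%N ->
    (l ^ i %| `|m|)%N -> (l ^ i %| `|y| ^ 2)%N.
  move=> dvd_s dvd_mi; have : ((l ^ i)%N%:Z %| y ^+ 2 * n)%Z.
    have -> : y ^+ 2 * n = (x ^+ 2 * m + y ^+ 2 * n) - x ^+ 2 * m by ring.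
    by rewrite rpredB ?dvdz_mull // dvdzE.
  by rewrite dvdzE /= abszM abszX Gauss_dvdl // coprimeXl.
move=> dvd_s; rewrite dvdzE /= in dvd_s.
have dvd_ye : (l ^ e.+1 %| `|y| ^ 2)%N.
  apply: odd_pfactor_dvd_square => //; apply: dvd_y => //.
  by apply: dvdn_trans dvd_s; rewrite dvdn_exp2l.
have l_y : (l %| `|y|)%N.
  have : (l %| `|y| ^ 2)%N by apply: dvdn_trans dvd_ye; rewrite dvdn_exp.
  by rewrite Euclid_dvdX // => /andP[].
have cop_lx : coprime l `|x|.
  by move: cop_xy; rewrite coprimezE coprime_sym; apply: coprime_dvdl.
have : ((l ^ e.+1)%N%:Z %| x ^+ 2 * m)%Z.
  have -> : x ^+ 2 * m = (x ^+ 2 * m + y ^+ 2 * n) - y ^+ 2 * n by ring.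
  by apply: rpredB; [rewrite dvdzE | apply: dvdz_mulr; rewrite dvdzE /= abszX].
rewrite dvdzE /= abszM abszX Gauss_dvdr ?coprimeXl ?coprimeXr //.
by rewrite pfactor_dvdn // ltnn.
Qed.

(* The only remaining obstruction after [even_logn_of_local_solutions] is the
   sign, and it is detected 2-adically since [-1] is not a square there. *)
Lemma local_global_diagonal (m n : int) :
  m != 0 -> n != 0 -> coprimez m n ->
  (forall l k, prime l -> exists x y : int,
     coprimez x y /\ ((l ^ k)%N%:Z %| x ^+ 2 * m + y ^+ 2 * n)%Z) ->
  exists x y : int, coprimez x y /\ x ^+ 2 * m + y ^+ 2 * n = 0.
Proof.
move=> m_neq0 n_neq0 cop loc.
have [s s_eq] : exists s, `|m|%N = (s ^ 2)%N.
  apply: square_even_logn => [|l l_pr]; first by rewrite absz_gt0.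
  by apply: (even_logn_of_local_solutions m_neq0 cop l_pr) => k; apply: loc.
have [t t_eq] : exists t, `|n|%N = (t ^ 2)%N.
  apply: square_even_logn => [|l l_pr]; first by rewrite absz_gt0.
  apply: (@even_logn_of_local_solutions n m) => // [|k].
    by rewrite coprimez_sym.
  have [x [y [cop_xy dvd_xy]]] := loc l k l_pr.
  by exists y, x; rewrite coprimez_sym addrC.
have cop_st : coprime s t.
  by move: cop; rewrite coprimezE s_eq t_eq coprime_pexpl // coprime_pexpr.
have s_gt0 : (0 < s)%N by lia.
have t_gt0 : (0 < t)%N by lia.
(* In [solve] and [clash], [d] will be the sign of [m]. For opposite signs, [x = t] and [y = s] is a
   solution. *)
have solve (d : int) : m = d * s%:Z ^+ 2 -> n = - d * t%:Z ^+ 2 ->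
    exists x y : int, coprimez x y /\ x ^+ 2 * m + y ^+ 2 * n = 0.
  move=> -> ->; exists t%:Z, s%:Z; split; last by ring.
  by rewrite coprimezE coprime_sym.
(* For equal signs, a relation modulo [2 ^ k.*2] makes [2 ^ k] divide both [|x| s] and [|y| t]. One
   of [x], [y] is odd, so [2 ^ k] divides [s] or [t], and the choice [k = s + t] makes it too large
   for either. *)
have clash (d : int) : `|d|%N = 1%N -> m = d * s%:Z ^+ 2 -> n = d * t%:Z ^+ 2 -> False.
  move=> d1 m_eq n_eq; pose k := (s + t)%N.
  have [x [y [cop_xy]]] := loc 2%N k.*2 isT.
  have sqrE (z : int) : z ^+ 2 = `|z|%N%:Z ^+ 2 by rewrite abszE real_normK ?num_real.
  have sumE : x ^+ 2 * m + y ^+ 2 * n = d * ((`|x| * s) ^ 2 + (`|y| * t) ^ 2)%N%:Z.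
    by rewrite m_eq n_eq (sqrE x) (sqrE y) PoszD !expnMn !PoszM; ring.
  have absE : `|(x ^+ 2 * m + y ^+ 2 * n)%R|%N = ((`|x| * s) ^ 2 + (`|y| * t) ^ 2)%N.
    by rewrite sumE abszM d1 mul1n.
  rewrite dvdzE /= absE => dvd_s.
  have dvd_x := pow2_dvd_sum_squares dvd_s.
  rewrite addnC in dvd_s; have dvd_y := pow2_dvd_sum_squares dvd_s.
  have lt_k : (k < 2 ^ k)%N by apply: ltn_expl.
  have [x_even|x_odd] := boolP (2 %| `|x|)%N.
    have cop_y : coprime (2 ^ k) `|y|.
      by apply: coprimeXl; move: cop_xy; rewrite coprimezE; apply: coprime_dvdl.
    move: dvd_y; rewrite (Gauss_dvdr _ cop_y) => /(dvdn_leq t_gt0) /(leq_trans lt_k).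
    by rewrite ltnNge leq_addl.
  have cop_x : coprime (2 ^ k) `|x| by rewrite coprimeXl // prime_coprime.
  move: dvd_x; rewrite (Gauss_dvdr _ cop_x) => /(dvdn_leq s_gt0) /(leq_trans lt_k).
  by rewrite ltnNge leq_addr.
have m_abs : m = `|m|%N%:Z \/ m = - `|m|%N%:Z by lia.
have n_abs : n = `|n|%N%:Z \/ n = - `|n|%N%:Z by lia.
rewrite s_eq t_eq in m_abs n_abs.
case: m_abs n_abs => m_eq [] n_eq.
- by case: (clash 1); rewrite ?mul1r.
- by apply: (solve 1); rewrite ?mulN1r ?mul1r.
- by apply: (solve (-1)); rewrite ?opprK ?mulN1r ?mul1r.
- by case: (clash (-1)); rewrite ?mulN1r.
Qed.

(** * Algebraic integers and primes of a number field *)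

Section AlgebraicIntegers.
Variable F : fieldExtType rat.
Implicit Types x y z : F.

Lemma alg_intP x : alg_int x <-> integralOver (intmul 1 : int -> F) x.
Proof. by split=> [[p [? ?]]|[p ? ?]]; exists p. Qed.

Lemma alg_intD x y : alg_int x -> alg_int y -> alg_int (x + y).
Proof. by rewrite !alg_intP; apply: integral_add. Qed.

Lemma alg_intB x y : alg_int x -> alg_int y -> alg_int (x - y).
Proof. by rewrite !alg_intP; apply: integral_sub. Qed.

Lemma alg_intM x y : alg_int x -> alg_int y -> alg_int (x * y).
Proof. by rewrite !alg_intP; apply: integral_mul. Qed.

Lemma alg_int_int (c : int) : alg_int (c%:~R : F).
Proof. by rewrite alg_intP; apply: integral_id. Qed.

Lemma alg_int_nat (n : nat) : alg_int (n%:R : F).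
Proof. exact: (alg_int_int n). Qed.

Lemma alg_int_sum (I : finType) (f : I -> F) :
  (forall i, alg_int (f i)) -> alg_int (\sum_i f i).
Proof.
move=> int_f; elim/big_ind: _ => // [|x y]; first exact: (alg_int_nat 0).
exact: alg_intD.
Qed.

Lemma intr_fieldExt_eq0 (c : int) : (c%:~R == 0 :> F) = (c == 0).
Proof. by rewrite -(rmorph_int (in_alg F)) fmorph_eq0 intr_eq0. Qed.

Lemma natr_fieldExt_eq0 (n : nat) : (n%:R == 0 :> F) = (n == 0%N).
Proof. exact: (intr_fieldExt_eq0 n). Qed.

(** Multiplying a monic equation of degree [n] for [1/p] by [p ^ n] would exhibit 1 as a multiple of
    [p]. *)
Lemma not_alg_int_inv (p : nat) : (1 < p)%N -> ~ alg_int (p%:R^-1 : F).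
Proof.
move=> p_gt1 [q [q_mon]].
have [n size_q] : exists n, size q = n.+1.
  by exists (size q).-1; apply: polySpred; apply: monic_neq0.
have p_neq0 : p%:R != 0 :> F by rewrite natr_fieldExt_eq0; lia.
rewrite /root (horner_coef_wide _ (n := n.+1)); last by rewrite -size_q; apply: size_poly.
move/eqP/(congr1 (fun x => x * p%:R ^+ n)); rewrite mul0r mulr_suml.
have -> : \sum_(i < n.+1) (map_poly (fun z : int => z%:~R : F) q)`_i * p%:R^-1 ^+ i * p%:R ^+ n
    = (\sum_(i < n.+1) q`_i * (p%:Z ^+ (n - i)))%:~R.
  rewrite rmorph_sum; apply: eq_bigr => i _.
  rewrite coef_map_id0 // rmorphM /= rmorphXn /= -mulrA; congr (_ * _).
  by rewrite exprVn mulrC expfB_cond -pmulrn // (negPf p_neq0) add0n leq_ord.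
move/eqP; rewrite intr_fieldExt_eq0 big_ord_recr /= subnn mulr1.
have -> : q`_n = 1 by move/monicP: q_mon; rewrite lead_coefE size_q.
rewrite addrC addr_eq0 => /eqP one_eq; suff : (p%:Z %| 1%R)%Z by rewrite dvdz1 /=; lia.
rewrite one_eq rpredN; apply: rpred_sum => i _; apply: dvdz_mull.
by apply: dvdz_exp; rewrite ?subn_gt0 ?dvdzz.
Qed.

(** For [p] prime and integral [b i], this is linear independence, over the field with [p] elements,
    of the classes of the [b i] in [O_F / p O_F]. *)
Definition independent_mod (p n : nat) (b : 'I_n -> F) : Prop :=
  forall (c : 'I_n -> int) z, alg_int z ->
    \sum_i (c i)%:~R * b i = p%:R * z -> forall i, (p %| c i)%Z.

(* A rational relation between the [b i] clears to an integral one, whose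
   coefficients are then divisible by every power of [p]. *)
Lemma independent_mod_leq_dim (p n : nat) (b : 'I_n -> F) :
  (1 < p)%N -> independent_mod p b -> (n <= \dim {:F})%N.
Proof.
move=> p_gt1 ind_b.
have dvd_pow m : forall c : 'I_n -> int, \sum_i (c i)%:~R * b i = 0 ->
    forall i, (p%:Z ^+ m %| c i)%Z.
  elim: m => [|m IHm] c sum0 i; first by rewrite expr0 dvdzE dvd1n.
  have dvd_c j : (p %| c j)%Z.
    by apply: (ind_b c 0); rewrite ?mulr0 //; apply: (alg_int_nat 0).
  rewrite -(divzK (dvd_c i)) exprSr dvdz_mul //.
  apply: (IHm (fun j => (c j %/ p)%Z)); apply: (@mulIf _ p%:R).
    by rewrite natr_fieldExt_eq0; lia.
  rewrite mul0r mulr_suml -{}[RHS]sum0; apply: eq_bigr => j _.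
  by rewrite -{2}(divzK (dvd_c j)) rmorphM /= mulrAC.
have rel0 (c : 'I_n -> int) : \sum_i (c i)%:~R * b i = 0 -> forall i, c i = 0.
  (* A nonzero [c i] cannot be divisible by [p ^ |c i|], which exceeds it in absolute value. *)
  move=> sum0 i; apply/eqP; apply: contraT; rewrite -absz_gt0 => c_gt0.
  have := dvd_pow `|c i|%N c sum0 i; rewrite dvdzE abszX /= => /(dvdn_leq c_gt0).
  by rewrite leqNgt ltn_expl.
suff free_b : free [tuple b i | i < n].
  move: (free_b); rewrite /free size_tuple => /eqP <-.
  exact/dimvS/subvf.
apply/freeP => k sum0.
(* Denominators are cleared: [c i] is the integer [D * k i]. *)
pose D := \prod_i denq (k i).
have D_neq0 : D != 0 by apply/prodf_neq0 => i _; apply: denq_neq0.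
pose c i := numq (k i) * \prod_(j | j != i) denq (k j).
have cE i : (c i)%:~R = D%:~R * k i :> rat.
  have -> : D = denq (k i) * \prod_(j | j != i) denq (k j) by rewrite /D (bigD1 i).
  by rewrite /c !intrM numqE; ring.
have c0 : forall i, c i = 0.
  apply: rel0; transitivity (D%:~R * \sum_i k i *: [tuple b i | i < n]`_i).
    rewrite mulr_sumr; apply: eq_bigr => i _; rewrite -tnth_nth tnth_mktuple.
    by rewrite -(rmorph_int (in_alg F) (c i)) cE /= -scalerAl mul1r -scalerA scaler_int mulrzl.
  by rewrite sum0 mulr0.
move=> i; apply/eqP; have /eqP := cE i.
by rewrite c0 eq_sym mulf_eq0 intr_eq0 (negPf D_neq0).
Qed.

(** The dimension bound yields an independent family modulo [p] of maximal length. It spans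
    [O_F / p O_F], so its combinations with coefficients below [p] represent every class; no
    integral basis is involved. *)
Lemma residues_mod_prime (p : nat) : prime p -> exists s : seq F,
  (forall y, y \in s -> alg_int y) /\
  forall x, alg_int x -> exists2 y, y \in s & exists2 z, alg_int z & x - y = p%:R * z.
Proof.
move=> p_pr; have p_gt1 := prime_gt1 p_pr; have p_gt0 := prime_gt0 p_pr.
pose Ind n := exists2 b : 'I_n -> F, forall i, alg_int (b i) & independent_mod p b.
have ex_Ind : exists n, `[< Ind n >].
  by exists 0%N; apply/asboolP; exists (fun=> 0) => [[]|c z _ _ []].
have le_Ind n : `[< Ind n >] -> (n <= \dim {:F})%N.
  by case/asboolP=> b _; apply: independent_mod_leq_dim.
case: (ex_maxnP ex_Ind le_Ind) => n /asboolP[b int_b ind_b] max_n.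
pose comb (e : {ffun 'I_n -> 'I_p}) := \sum_i (e i : nat)%:R * b i.
exists [seq comb e | e : {ffun 'I_n -> 'I_p}]; split=> [y /mapP[e _ ->]|x int_x].
  by apply: alg_int_sum => i; apply: alg_intM => //; apply: alg_int_nat.
(* By maximality, adjoining [x] as entry [ord0] destroys independence. If [p] divided the
   coefficient of [x], that term could be moved into [p * z], and independence of [b] would make all
   coefficients divisible by [p]. *)
have [c [z [int_z sum_c c0_ndvd]]] : exists c : 'I_n.+1 -> int, exists z,
    [/\ alg_int z, (c ord0)%:~R * x + \sum_i (c (lift ord0 i))%:~R * b i = p%:R * z
      & ~~ (p %| c ord0)%Z].
  apply: contrapT => no_rel; suff : (n.+1 <= n)%N by rewrite ltnn.
  apply: max_n; apply/asboolP; exists (fun i => oapp b x (unlift ord0 i)).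
    by move=> i; case: (unliftP ord0 i) => [j|] _ /=.
  move=> c z int_z; rewrite big_ord_recl unlift_none /=.
  under eq_bigr => i _ do rewrite liftK /=.
  move=> sum_c; have [dvd0|ndvd0] := boolP (p %| c ord0)%Z; last first.
    by case: no_rel; exists c, z.
  move=> i; case: (unliftP ord0 i) => [j|] -> //.
  apply: (ind_b (fun i => c (lift ord0 i)) (z - (c ord0 %/ p)%Z%:~R * x)).
    by apply: alg_intB => //; apply: alg_intM => //; apply: alg_int_int.
  rewrite mulrBr -sum_c -{1}(divzK dvd0) rmorphM /=; ring.
have cop : coprimez (c ord0) p by rewrite coprimezE coprime_sym /= prime_coprime.
have [[u w] /= uw1] := coprimezP _ _ cop.
(* [u] inverts the coefficient of [x] modulo [p], so the relation can be solved for [x]; [e i] is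
   the reduced coefficient of [b i] in the result. *)
have [e eE] : exists e : 'I_n -> 'I_p, forall i,
    exists q : int, - u * c (lift ord0 i) = q * p + (e i : nat).
  apply: (@fin_all_exists _ _ (fun i (j : 'I_p) =>
    exists q : int, - u * c (lift ord0 i) = q * p + (j : nat))) => i.
  have p_neq0 : p%:Z != 0 by lia.
  set a := - u * _; have a_lt : (`|(a %% p)%Z| < p)%N.
    have := ltz_pmod a (_ : 0 < p%:Z); have := modz_ge0 a p_neq0; lia.
  exists (Ordinal a_lt), (a %/ p)%Z => /=.
  by rewrite gez0_abs ?modz_ge0 // -divz_eq.
have [q qE] := fin_all_exists eE.
exists (comb (finfun e)); first by apply: map_f; rewrite mem_enum.
exists (u%:~R * z + w%:~R * x + \sum_i (q i)%:~R * b i).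
  apply: alg_intD; last by apply: alg_int_sum => i; apply: alg_intM => //; apply: alg_int_int.
  by apply: alg_intD; apply: alg_intM => //; apply: alg_int_int.
have sumE : (- u)%:~R * \sum_i (c (lift ord0 i))%:~R * b i =
    p%:R * (\sum_i (q i)%:~R * b i) + comb (finfun e).
  rewrite !mulr_sumr -big_split; apply: eq_bigr => i _ /=.
  rewrite ffunE mulrA -rmorphM /= qE rmorphD rmorphM /=; ring.
have x_eq : x = (u * c ord0 + w * p%:Z)%:~R * x by rewrite uw1 mul1r.
rewrite {1}x_eq rmorphD !rmorphM /= -[comb _](addKr (p%:R * (\sum_i (q i)%:~R * b i))) -sumE.
rewrite rmorphN /= mulrDr mulrDr [p%:R * (_ * z)]mulrCA -sum_c; ring.
Qed.

End AlgebraicIntegers.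

(** * Primes of a number field: existence, finiteness and density *)

Section Primes.
Variable F : fieldExtType rat.
Implicit Types (x y z : F) (v w : nfprime F).

Lemma nfprime_alg_int v x : sval v x -> alg_int x.
Proof. by case: v => w /= [H _]; apply: H. Qed.

Lemma nfprime0 v : sval v 0.
Proof. by case: v => w /= [_ []]. Qed.

Lemma nfprimeD v x y : sval v x -> sval v y -> sval v (x + y).
Proof. by case: v => w /= [_ [_ [H _]]]; apply: H. Qed.

Lemma nfprimeM v a x : alg_int a -> sval v x -> sval v (a * x).
Proof. by case: v => w /= [_ [_ [_ [H _]]]]; apply: H. Qed.

Lemma nfprime1 v : ~ sval v 1.
Proof. by case: v => w /= [_ [_ [_ [_ []]]]]. Qed.

Lemma nfprime_prime v a b :
  alg_int a -> alg_int b -> sval v (a * b) -> sval v a \/ sval v b.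
Proof. by case: v => w /= [_ [_ [_ [_ [_ [_ H]]]]]]; apply: H. Qed.

Lemma nfprimeMr v a x : alg_int a -> sval v x -> sval v (x * a).
Proof. by rewrite mulrC; apply: nfprimeM. Qed.

Lemma nfprimeN v x : sval v x -> sval v (- x).
Proof. by rewrite -mulN1r; apply: nfprimeM; apply: (alg_int_int F (-1)). Qed.

Lemma nfprimeB v x y : sval v x -> sval v y -> sval v (x - y).
Proof. by move=> vx vy; apply/nfprimeD/nfprimeN. Qed.

Lemma nfprime_subr v x y : sval v (x - y) -> sval v x <-> sval v y.
Proof.
move=> vxy; split=> [vx|vy]; last by rewrite -(subrK y x); apply: nfprimeD.
by rewrite -(subKr x y); apply: nfprimeB.
Qed.

Lemma nfprime_inj v w : (forall x, sval v x <-> sval w x) -> v = w.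
Proof.
case: v w => [v pv] [w pw] /= eq_vw; apply: eq_exist.
by apply: funext => x; apply: propext.
Qed.

Lemma nfprime_coprime v (m n : nat) : coprime m n -> sval v m%:R -> ~ sval v n%:R.
Proof.
move=> cop vm vn; apply: (@nfprime1 v).
have [[a b] /= ab1] := coprimezP m n cop.
have -> : 1 = a%:~R * m%:R + b%:~R * n%:R :> F.
  by rewrite (pmulrn _ m) (pmulrn _ n) -!intrM -intrD ab1.
by apply: nfprimeD; apply: nfprimeM => //; apply: alg_int_int.
Qed.

Lemma nfprime_pdiv v (n : nat) :
  (0 < n)%N -> sval v n%:R -> exists p, [/\ prime p, (p <= n)%N & sval v p%:R].
Proof.
elim/ltn_ind: n => n IHn n_gt0 vn.
have n_gt1 : (1 < n)%N by case: n vn n_gt0 {IHn} => [|[|]] // /nfprime1.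
have p_pr := pdiv_prime n_gt1; have dvd_p := pdiv_dvd n.
have q_gt0 : (0 < n %/ pdiv n)%N by rewrite divn_gt0 ?pdiv_gt0 //; apply: dvdn_leq.
move: (vn); rewrite -{1}(divnK dvd_p) natrM => /nfprime_prime[].
- exact: alg_int_nat.
- exact: alg_int_nat.
- case/IHn => // [|p [? le_p ?]]; first by rewrite ltn_Pdiv // prime_gt1.
  by exists p; split=> //; apply: leq_trans le_p (leq_div _ _).
- by exists (pdiv n); split=> //; apply: dvdn_leq.
Qed.

Lemma finite_fibers_list (T : Type) (U : finType) (f : T -> U) (A : T -> Prop) :
  (forall v w : T, A v -> A w -> f v = f w -> v = w) -> exists l, forall v : T, A v -> List.In v l.
Proof.
move=> inj_f; suff [l lP] : exists l, forall v : T, A v -> f v \in enum U -> List.In v l.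
  by exists l => v Av; apply: lP => //; rewrite mem_enum.
elim: (enum U) => [|u us [l lP]]; first by exists [::].
have [[v [Av fv]]|no_v] := EM (exists v : T, A v /\ f v = u); last first.
  by exists l => v Av; rewrite inE => /orP[/eqP fv|]; [case: no_v; exists v | apply: lP].
exists (v :: l) => w Aw; rewrite inE => /orP[/eqP fw|/lP]; last by right; auto.
by left; apply: inj_f; rewrite ?fv.
Qed.

(** A prime containing [p] is a union of classes modulo [p], so it is determined by the boolean
    vector telling which representatives it contains. *)
Lemma finitely_many_above (p : nat) :
  prime p -> exists l, forall v, sval v p%:R -> List.In v l.
Proof.
move=> p_pr; have [s [int_s res_s]] := residues_mod_prime F p_pr.
apply: (@finite_fibers_list _ _ (fun v =>
  [tuple `[< sval v (tnth (in_tuple s) i) >] | i < size s])).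
have incl (u u' : nfprime F) : sval u p%:R -> sval u' p%:R ->
    (forall y, y \in s -> sval u y -> sval u' y) -> forall x, sval u x -> sval u' x.
  move=> up u'p uu' x ux; have int_x := nfprime_alg_int ux.
  have [y ys [z int_z xy]] := res_s x int_x.
  apply/(nfprime_subr (y := y)); first by rewrite xy; apply: nfprimeMr.
  apply: uu' => //; apply/(nfprime_subr (x := x) (y := y)) => //.
  by rewrite xy; apply: nfprimeMr.
move=> v w vp wp eq_vw.
have eq_s y : y \in s -> sval v y <-> sval w y.
  case/(tnthP (in_tuple s)) => i ->; apply: asbool_eq_equiv.
  by move/(congr1 (fun t => tnth t i)): eq_vw; rewrite !tnth_mktuple.
by apply: nfprime_inj => x; split; apply: incl => // y /eq_s[].
Qed.

(** Pigeonhole: two of the [n + 1] integers from 0 to [n] are congruent modulo [v], and [m] is their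
    difference. *)
Lemma has_norm_nat v (n : nat) :
  has_norm v n -> exists m, [/\ (0 < m)%N, (m <= n)%N & sval v m%:R].
Proof.
case=> s [size_s int_s incong_s cover_s].
have [f fP] : exists f : 'I_n.+1 -> 'I_n, forall i : 'I_n.+1, sval v ((i : nat)%:R - nth 0 s (f i)).
  apply: (@fin_all_exists _ _ (fun (i : 'I_n.+1) (j : 'I_n) =>
    sval v ((i : nat)%:R - nth 0 s j))) => i.
  have [j j_lt vj] := cover_s _ (alg_int_nat F i).
  by exists (Ordinal j_lt).
have : ~~ injectiveb f.
  by apply/negP => /injectiveP /leq_card; rewrite !card_ord ltnn.
case/injectivePn => i0 [j0 neq_ij0 eq_f0].
have [i [j [lt_ij eq_f]]] : exists i j : 'I_n.+1, (i < j)%N /\ f i = f j.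
  have: (i0 : nat) != j0 by [].
  by rewrite neq_ltn => /orP[lt_ij|lt_ji]; [exists i0, j0 | exists j0, i0].
exists (j - i)%N; split; first by rewrite subn_gt0.
  exact: leq_trans (leq_subr _ _) (leq_ord j).
rewrite natrB 1?ltnW // -(subrKA (nth 0 s (f i))) -[nth 0 s (f i) - _]opprB.
by apply: nfprimeB => //; rewrite eq_f.
Qed.

(** Such a prime contains a positive integer at most [X], hence a rational prime at most [X], and
    finitely many primes lie above each of these. *)
Lemma finitely_many_of_norm_leq (X : nat) :
  exists l, forall v, (exists2 m, (m <= X)%N & has_norm v m) -> List.In v l.
Proof.
suff [l lP] : exists l, forall v p, prime p -> (p <= X)%N -> sval v p%:R -> List.In v l.
  exists l => v [n n_le /has_norm_nat[m [m_gt0 m_le /(nfprime_pdiv m_gt0)[p [p_pr p_le vp]]]]].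
  by apply: (lP v p) => //; apply: leq_trans p_le (leq_trans m_le n_le).
elim: X => [|X [l lP]]; first by exists [::] => v [].
have [l' lP'] : exists l', prime X.+1 -> forall v, sval v X.+1%:R -> List.In v l'.
  have [/finitely_many_above[l' lP']|_] := boolP (prime X.+1); last by exists [::].
  by exists l'.
exists (l ++ l') => v p p_pr; rewrite leq_eqVlt => p_le vp; apply/List.in_app_iff.
case/orP: p_le p_pr vp => [/eqP-> p_pr vp|p_lt p_pr vp]; first by right; apply: lP'.
by left; apply: (lP v p).
Qed.

Definition is_ideal (I : F -> Prop) : Prop :=
  [/\ forall x, I x -> alg_int x, forall x y, I x -> I y -> I (x + y)
    & forall a x, alg_int a -> I x -> I (a * x)].

(* Among the proper ideals containing [p], one containing the largest number of
   representatives modulo [p] is maximal. *)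
Lemma nfprime_above (p : nat) : prime p -> exists v, sval v p%:R.
Proof.
move=> p_pr; have [s [int_s res_s]] := residues_mod_prime F p_pr.
have int_p := alg_int_nat F p.
pose proper I := [/\ is_ideal I, I p%:R & ~ I 1].
pose cnt (I : F -> Prop) := count (fun y => `[< I y >]) s.
have ex_ideal : exists n, `[< exists2 I, proper I & cnt I = n >].
  (* The starting ideal is [p O_F], proper because [1/p] is not integral. *)
  pose I0 x := exists2 z, alg_int z & x = p%:R * z.
  exists (cnt I0); apply/asboolP; exists I0 => //; split.
  - split=> [x [z int_z ->]|x y [z int_z ->] [t int_t ->]|a x int_a [z int_z ->]].
    + exact: alg_intM.
    + by exists (z + t); [apply: alg_intD | rewrite mulrDr].
    + by exists (a * z); [apply: alg_intM | rewrite mulrCA].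
  - by exists 1; [apply: (alg_int_nat F 1) | rewrite mulr1].
  case=> z int_z pz1; apply: (@not_alg_int_inv F p); first exact: prime_gt1.
  have p_neq0 : p%:R != 0 :> F by rewrite natr_fieldExt_eq0 -lt0n prime_gt0.
  by have -> : p%:R^-1 = z by apply: (mulfI p_neq0); rewrite mulfV; first exact: pz1.
have le_size n : `[< exists2 I, proper I & cnt I = n >] -> (n <= size s)%N.
  by case/asboolP=> I _ <-; apply: count_size.
case: (ex_maxnP ex_ideal le_size) => n /asboolP[I [[I_int ID IM] Ip I1] cntI] max_n.
have I0 : I 0 by rewrite -(mul0r p%:R); apply: IM => //; apply: (alg_int_nat F 0).
have IN x : I x -> I (- x) by rewrite -mulN1r; apply: IM; apply: (alg_int_int F (-1)).
suff prI : is_nfprime I by exists (exist _ I prI).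
split=> //; split=> //; split=> //; split=> //; split=> //; split.
  by exists p%:R; split=> //; apply/eqP; rewrite natr_fieldExt_eq0 -lt0n prime_gt0.
move=> a b int_a int_b Iab; have [Ia|nIa] := EM (I a); [by left | right].
(* [J] is the ideal [I + O_F a]. If it contains 1, multiplying by [b] puts [b] in [I]; otherwise it
   is a proper ideal whose count contradicts maximality. *)
pose J x := exists i c, [/\ I i, alg_int c & x = i + c * a].
have IJ x : I x -> J x.
  by move=> Ix; exists x, 0; split; rewrite ?mul0r ?addr0 //; apply: (alg_int_nat F 0).
have Ja : J a.
  by exists 0, 1; split; rewrite ?mul1r ?add0r //; apply: (alg_int_nat F 1).
have [[i [c [Ii int_c one_eq]]]|nJ1] := EM (J 1).
  rewrite -[b]mul1r one_eq mulrDl mulrC; apply: ID; first exact: IM.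
  by rewrite -mulrA; apply: IM.
have idJ : is_ideal J.
  split=> [x [i [c [Ii int_c ->]]]
    |x y [i [c [Ii int_c ->]]] [j [d [Ij int_d ->]]]
    |d x int_d [i [c [Ii int_c ->]]]].
  - by apply: alg_intD; [apply: I_int | apply: alg_intM].
  - by exists (i + j), (c + d); split; [apply: ID | apply: alg_intD | rewrite mulrDl addrACA].
  - by exists (d * i), (d * c); split; [apply: IM | apply: alg_intM | rewrite mulrDr mulrA].
have le_cnt : (cnt J <= n)%N.
  by apply: max_n; apply/asboolP; exists J => //; split=> //; apply: IJ.
(* Since [p] is in [I], the representative [y] of [a] lies in [J] but not in [I], so [J] has the
   larger count. *)
have [y ys [z int_z ay]] := res_s a int_a.
have Ipz : I (p%:R * z) by rewrite mulrC; apply: IM.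
have nIy : ~ I y by move=> Iy; apply: nIa; rewrite -(subrK y a) ay; apply: ID.
have Jy : J y.
  have [_ JD _] := idJ; rewrite -(subKr a y) ay.
  by apply: JD => //; apply/IJ/IN.
have : (cnt I < cnt J)%N; last by rewrite cntI ltnNge le_cnt.
case/splitPr: ys @cnt {le_cnt cntI max_n ex_ideal le_size res_s int_s} => s1 s2 /=.
rewrite !count_cat /=; do 2![case: asboolP => //] => _ _; rewrite add0n addnS.
rewrite ltnS leq_add // sub_count // => x /asboolP Ix; apply/asboolP; exact: IJ.
Qed.

(** As [p] is in [v], representatives modulo [p] cover all classes modulo [v]; it remains to keep
    one per class. *)
Lemma has_norm_above v (p : nat) : prime p -> sval v p%:R -> exists n, has_norm v n.
Proof.
move=> p_pr vp; have [s [int_s res_s]] := residues_mod_prime F p_pr.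
suff [t [int_t inc_t cov_t]] : exists t : seq F, [/\ forall y, y \in t -> alg_int y,
    pairwise (fun x y => ~~ `[< sval v (x - y) >]) t &
    forall y, y \in s -> exists2 x, x \in t & sval v (y - x)].
  exists (size t), t; split=> // [i lt_i|i j lt_i lt_j neq_ij|x int_x].
  - by apply: int_t; rewrite mem_nth.
  - move: inc_t => /(pairwiseP 0) inc_t.
    case: (ltngtP i j) neq_ij => // lt_ij _ vij.
      by have /asboolP := inc_t i j lt_i lt_j lt_ij.
    have /asboolP := inc_t j i lt_j lt_i lt_ij; apply.
    by rewrite -opprB; apply: nfprimeN.
  - have [y ys [z int_z xy]] := res_s x int_x; have [w wt vyw] := cov_t y ys.
    exists (index w t); first by rewrite index_mem.
    rewrite nth_index // -(subrKA y); apply: nfprimeD => //.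
    by rewrite xy; apply: nfprimeMr.
elim: s int_s {res_s} => [|y s IHs] int_s; first by exists [::].
have [|t [int_t inc_t cov_t]] := IHs; first by move=> x xs; apply: int_s; rewrite inE xs orbT.
have [[x [xt vyx]]|no_x] := EM (exists x, x \in t /\ sval v (y - x)).
  by exists t; split=> // u; rewrite inE => /orP[/eqP->|/cov_t //]; exists x.
exists (y :: t); split=> [u|/=|u].
- by rewrite inE => /orP[/eqP->|/int_t //]; apply: int_s; rewrite mem_head.
- rewrite inc_t andbT; apply/allP => x xt; apply/asboolP => vyx.
  by apply: no_x; exists x.
- rewrite inE => /orP[/eqP->|/cov_t[x xt vux]].
    by exists y; rewrite ?mem_head // subrr; apply: nfprime0.
  by exists x; rewrite // inE xt orbT.
Qed.

(** Each prime of [F] contains at most one rational prime, so any prime above a large enough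
    rational prime is outside [l]. *)
Lemma exists_nfprime_notin (l : list (nfprime F)) :
  exists v n, has_norm v n /\ ~ List.In v l.
Proof.
have [M MP] : exists M, forall p, prime p -> (M < p)%N -> forall v, List.In v l -> ~ sval v p%:R.
  elim: l => [|v l [M MP]]; first by exists 0%N.
  have [[q [q_pr vq]]|no_q] := EM (exists q, prime q /\ sval v q%:R); last first.
    exists M => p p_pr lt_p w [<- vp|]; last exact: MP.
    by apply: no_q; exists p.
  exists (maxn M q) => p p_pr; rewrite gtn_max => /andP[lt_Mp lt_qp] w [<-|]; last exact: MP.
  apply: nfprime_coprime vq; rewrite prime_coprime // dvdn_prime2 //.
  by rewrite neq_ltn lt_qp.
have [p lt_p p_pr] := prime_above M.
have [v vp] := nfprime_above p_pr; have [n norm_v] := has_norm_above p_pr vp.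
by exists v, n; split=> // /(MP p p_pr lt_p).
Qed.

(** This makes the denominators of the density ratios unbounded. *)
Lemma many_nfprimes (N : nat) : exists X (l : list (nfprime F)),
  [/\ List.NoDup l, length l = N &
    forall v, List.In v l -> exists2 m, (m <= X)%N & has_norm v m].
Proof.
elim: N => [|N [X [l [nodup_l len_l norm_l]]]].
  by exists 0%N, [::]; split=> //; apply: List.NoDup_nil.
have [v [n [norm_v v_notin]]] := exists_nfprime_notin l.
exists (maxn X n), (v :: l); split=> [||w [<-|/norm_l[m m_le norm_w]]].
- exact: List.NoDup_cons.
- by rewrite /= len_l.
- by exists n => //; apply: leq_maxr.
- by exists m => //; apply: leq_trans m_le (leq_maxl _ _).
Qed.

Lemma sublist_nodup (T : Type) (A : T -> Prop) (l : list T) :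
  exists2 l', List.NoDup l' & forall v : T, List.In v l' <-> List.In v l /\ A v.
Proof.
elim: l => [|u l [l' nodup lP]]; first by exists [::]; [apply: List.NoDup_nil | split=> // -[]].
have [[Au u_notin]|no_u] := EM (A u /\ ~ List.In u l').
  exists (u :: l') => [|v]; first exact: List.NoDup_cons.
  split=> [[<-|/lP[]]|[[->|vl] Av]] /=; [by split; [left|] | by split; [right|] | by left |].
  by right; apply/lP.
exists l' => // v; split=> [/lP[vl Av]|[[<-|vl] Av]]; first by split; [right|].
  by apply: contrapT => u_notin; apply: no_u.
exact/lP.
Qed.

(** [pos_density] speaks only of counts that exist, so its lower bound can be exploited once
    existence is known. *)
Lemma prime_count_exists (S : nfprime F -> Prop) (X : nat) : exists n, prime_count S X n.
Proof.
have [l lP] := finitely_many_of_norm_leq X.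
have [l' nodup lP'] :=
  sublist_nodup (fun v => S v /\ exists2 m, (m <= X)%N & has_norm v m) l.
exists (length l'), l'; split=> // v; split=> [/lP'[]//|[Sv norm_v]].
by apply/lP'; split=> //; apply: lP.
Qed.

(** If [S] lay inside [l], the numerators of its density ratios would be at most [length l] while
    the denominators grow, against the lower bound [c]. *)
Lemma pos_density_avoids (S : nfprime F -> Prop) (l : list (nfprime F)) :
  pos_density S -> exists v, S v /\ ~ List.In v l.
Proof.
case=> _ [c c_gt0 [X0 densS]]; apply: contrapT => no_v.
have sub_l v : S v -> List.In v l.
  by move=> Sv; apply: contrapT => v_notin; apply: no_v; exists v.
(* [N] exceeds [k / c], so a ratio with numerator at most [k] and denominator at least [N] is below
   [c]. *)
pose k := length l; pose N := (Num.Def.archi_bound (k%:R / c)).+1.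
have [X1 [l1 [nodup1 len1 norm1]]] := many_nfprimes N.
pose X := maxn X0 X1.
have [nX countS] := prime_count_exists S X.
have [mX countT] := prime_count_exists (fun=> True) X.
have := densS X nX mX (leq_maxl _ _) countS countT.
have nX_le : (nX <= k)%N.
  case: countS => lS [nodupS <- lSP]; apply/ssrnat.leP; apply: List.NoDup_incl_length => // v.
  by case/lSP=> /sub_l.
have mX_ge : (N <= mX)%N.
  case: countT => lT [_ <- lTP]; rewrite -len1; apply/ssrnat.leP.
  apply: List.NoDup_incl_length => // v /norm1[m m_le norm_v]; apply/lTP; split=> //.
  by exists m => //; apply: leq_trans m_le (leq_maxr _ _).
have mX_gt0 : 0 < mX%:R :> rat by rewrite ltr0n; apply: leq_trans mX_ge.
rewrite /density_ratio ler_pdivlMr // leNgt => /negP; apply.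
have kc_ge0 : 0 <= k%:R / c by apply: divr_ge0; rewrite ?ler0n // ltW.
have lt_kN : k%:R / c < mX%:R.
  apply: lt_le_trans (archi_boundP kc_ge0) _; rewrite ler_nat.
  exact: leq_trans (leqnSn _) mX_ge.
rewrite ltr_pdivrMr // mulrC in lt_kN.
by apply: le_lt_trans lt_kN; rewrite ler_nat.
Qed.

End Primes.

(** * Reduction maps *)

Section Torsion.
Variable B : zmodType.
Implicit Types P Q : B.

Lemma torsion0 : torsion (0 : B).
Proof. by exists 1%N. Qed.

Lemma torsionMz P (c : int) : torsion P -> torsion (P *~ c).
Proof. by case=> n n_gt0 Pn0; exists n => //; rewrite pmulrn mulrzAC -pmulrn Pn0 mul0rz. Qed.

Lemma torsionD P Q : torsion P -> torsion Q -> torsion (P + Q).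
Proof.
case=> n n_gt0 Pn0 [m m_gt0 Qm0]; exists (n * m)%N; first by rewrite muln_gt0 n_gt0.
by rewrite mulrnDl mulrnA Pn0 mul0rn mulnC mulrnA Qm0 mul0rn addr0.
Qed.

Lemma torsionN P : torsion P -> torsion (- P).
Proof. by case=> n n_gt0 Pn0; exists n => //; rewrite mulNrn Pn0 oppr0. Qed.

Lemma torsion_of_mulz P (c : int) : c != 0 -> torsion (P *~ c) -> torsion P.
Proof.
move=> c_neq0 [n n_gt0 Pcn0]; exists (`|c| * n)%N.
  by rewrite muln_gt0 absz_gt0 c_neq0.
rewrite mulrnA (pmulrn P); have [-> //|->] : `|c|%N%:Z = c \/ `|c|%N%:Z = - c by lia.
by rewrite mulrNz mulNrn Pcn0 oppr0.
Qed.

End Torsion.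

Lemma order_dvd_mulz (G : finZmodType) (x : G) (c : int) :
  x *~ c = 0 -> (#[x]%g %| `|c|)%N.
Proof.
move=> xc0; rewrite cyclic.order_dvdn FinRing.zmodXgE pmulrn; apply/eqP.
have [->|->] : `|c|%N%:Z = c \/ `|c|%N%:Z = - c by lia.
  exact: xc0.
by rewrite mulrNz xc0 oppr0.
Qed.

(** The price of cancelling [N] is its [l]-adic valuation; [N] will be an integer killing the
    torsion. *)
Lemma pfactor_dvd_mul (l k N c : nat) :
  prime l -> (0 < N)%N -> (l ^ (k + logn l N) %| N * c)%N -> (l ^ k %| c)%N.
Proof.
move=> l_pr N_gt0; have [-> //|c_gt0] := posnP c.
by rewrite !pfactor_dvdn ?muln_gt0 ?N_gt0 // lognM // addnC leq_add2l.
Qed.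

(** * From relations modulo primes to relations in [B] *)

Section LocalToGlobal.
Variables (F : fieldExtType rat) (B : zmodType) (Bv : nfprime F -> finZmodType).
Variable r : forall v, {additive B -> Bv v}.
Hypotheses (hA1 : assumptionA1 r) (hA2 : assumptionA2 r).

Lemma torsion_exponent : exists2 N : nat, (0 < N)%N & forall T : B, torsion T -> T *+ N = 0.
Proof.
have [l injT] := hA2.
(* (A1) for the empty family gives a set of positive density, hence a prime [v] where (A2) provides
   injectivity; the order of [Bv v] then kills the torsion. *)
have [|S [densS _]] := @hA1 2%N isT 0%N (fun=> 0%N) (fun=> 0).
  by move=> a _ [].
have [v [_ /injT inj_v]] := pos_density_avoids l densS.
exists #|[set: Bv v]|%N => [|T torsT]; first by rewrite cardG_gt0.
apply: inj_v; first by rewrite pmulrn; apply: torsionMz.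
  exact: torsion0.
by rewrite raddfMn raddf0 -FinRing.zmodXgE; apply/eqP;
  rewrite -cyclic.order_dvdn cyclic.order_dvdG ?inE.
Qed.

(** Multiplication by [N] kills [T], so [N c R] reduces to zero. *)
Lemma ord_v_dvd_of_torsion (N : nat) (v : nfprime F) (R T : B) (c : int) :
  (forall T : B, torsion T -> T *+ N = 0) -> torsion T -> r v (R *~ c) = r v T ->
  (ord_v r v R %| N * `|c|)%N.
Proof.
move=> killN torsT eq_v; have -> : (N * `|c|)%N = `|(N%:Z * c)%R|%N by rewrite abszM.
apply: order_dvd_mulz; rewrite -raddfMz mulrC mulrzA raddfMz eq_v -raddfMz -pmulrn.
by rewrite killN ?raddf0.
Qed.

Lemma independent_not_locally_solvable (P Q : B) :
  (forall a b : int, P *~ a + Q *~ b = 0 -> a = 0 /\ b = 0) ->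
  ~ almost_all (fun v : nfprime F => exists x y : int, coprimez x y /\
      exists2 T : B, torsion T & r v (P *~ (x ^+ 2) + Q *~ (y ^+ 2)) = r v T).
Proof.
move=> indep [l loc]; have [N N_gt0 killN] := torsion_exponent.
(* The combination equals [x^2 (P + 2Q) + (y^2 - 2 x^2) Q]. Odd order for [P] itself would lead only
   to [4 | y^2], which coprime [x], [y] can satisfy. *)
pose PP (i : 'I_2) := if i == 0 then P + Q *~ 2 else Q.
(* The value 0 requests odd order. In the other exponent, 2 gives a congruence modulo 4 and
   [logn 2 N] compensates for the torsion. *)
pose K (i : 'I_2) := if i == 0 then 0%N else (2 + logn 2 N)%N.
have [|S [densS ordS]] := @hA1 2%N isT _ K PP.
  move=> a; rewrite !big_ord_recl big_ord0 addr0 /PP /=.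
  rewrite mulrzDl -mulrzA -addrA -mulrzDr => /indep[a0 a1] i.
  case: (unliftP ord0 i) => [j ->|-> //].
  by rewrite (ord1 j); move: a1; rewrite a0 mulr0 add0r.
have [v [Sv /loc[x [y [cop_xy [T torsT eq_v]]]]]] := pos_density_avoids l densS.
have /= u_odd := ordS v Sv ord0.
have /= [dvdQ _] := ordS v Sv (lift ord0 ord0).
rewrite /PP /= in u_odd; set u := ord_v r v _ in u_odd.
(* Multiplying by [u], the order of the reduction of [P + 2Q], leaves only the multiple of [Q]; as
   [u] is odd, it does not affect the divisibility by 4. *)
have dvd_order : (ord_v r v Q %| N * `|((y ^+ 2 - x ^+ 2 *+ 2) * u%:Z)%R|)%N.
  apply: (@ord_v_dvd_of_torsion _ _ _ (T *~ u)) => //; first exact: torsionMz.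
  rewrite (raddfMz _ u T) -eq_v mulrzA raddfMz.
  have -> : P *~ (x ^+ 2) + Q *~ (y ^+ 2) =
      (P + Q *~ 2) *~ (x ^+ 2) + Q *~ (y ^+ 2 - x ^+ 2 *+ 2).
    by rewrite mulrzDl -mulrzA -addrA -mulrzDr; congr (_ + Q *~ _); ring.
  rewrite raddfD [(_ + r v _) *~ _]mulrzDl; suff -> : r v ((P + Q *~ 2) *~ x ^+ 2) *~ u = 0.
    by rewrite add0r.
  rewrite raddfMz mulrzAC -pmulrn -FinRing.zmodXgE expg_order.
  exact: mul0rz.
have /(pfactor_dvd_mul (isT : prime 2) N_gt0) := dvdn_trans dvdQ dvd_order.
rewrite abszM Gauss_dvdl; last by rewrite coprimeXl // prime_coprime.
move=> dvd4; have /dvdzP[q q_eq] : (4 %| y ^+ 2 - x ^+ 2 *+ 2)%Z by rewrite dvdzE.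
have even_sqr (z w : int) : z ^+ 2 = w * 2 -> (2 %| z)%Z.
  move=> z_eq; have : (2 %| z ^+ 2)%Z by apply/dvdzP; exists w.
  by rewrite !dvdzE abszX Euclid_dvdX // => /andP[].
(* From [y^2 = 2 x^2] modulo 4, first [y] is even, then [4 | 2 x^2] makes [x] even as well. *)
have y_even : (2 %| y)%Z.
  by apply: (even_sqr _ (q * 2 + x ^+ 2)); rewrite -[LHS](subrK (x ^+ 2 *+ 2)) q_eq; ring.
have /dvdzP[z y_eq] := y_even.
have x_even : (2 %| x)%Z.
  apply: (even_sqr _ (z ^+ 2 - q)); apply: (@mulIf _ 2) => //.
  have -> : (z ^+ 2 - q) * 2 * 2 = (z * 2) ^+ 2 - q * 4 by ring.
  by rewrite -q_eq y_eq; ring.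
by have := dvdz_gcd 2 x y; rewrite x_even y_even (eqP cop_xy).
Qed.

(** Dividing the relation by [g = gcd(a, b)] leaves a torsion point [S = a' P + b' Q]. With
    [u a' + v b' = 1] and [R = v P - u Q], one gets [P = b' R + u S] and [Q = - a' R + v S]. *)
Lemma dependent_common_divisor (P Q : B) (a b : int) :
  ~ torsion P -> ~ torsion Q -> P *~ a + Q *~ b = 0 -> ~ (a = 0 /\ b = 0) ->
  exists (R : B) (m n : int), [/\ m != 0, n != 0, coprimez m n &
    exists TP TQ : B, [/\ torsion TP, torsion TQ, P = R *~ m + TP & Q = R *~ n + TQ]].
Proof.
move=> hP hQ rel ab_neq0.
have b_neq0 : b != 0.
  apply/eqP=> b0; case: hP; apply: (@torsion_of_mulz _ _ a).
    by apply/eqP=> a0; case: ab_neq0.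
  by exists 1%N; rewrite // -rel b0 addr0.
have a_neq0 : a != 0.
  apply/eqP=> a0; case: hQ; apply: (torsion_of_mulz b_neq0).
  by exists 1%N; rewrite // -rel a0 add0r.
pose g := gcdz a b; have g_neq0 : g != 0 by rewrite gcdz_eq0 negb_and a_neq0.
have aE : a = (a %/ g)%Z * g by rewrite divzK ?dvdz_gcdl.
have bE : b = (b %/ g)%Z * g by rewrite divzK ?dvdz_gcdr.
set a' := (a %/ g)%Z in aE; set b' := (b %/ g)%Z in bE.
have [[u v]] : exists uv : int * int, uv.1 * a + uv.2 * b = g.
  by have [u [v uv]] := Bezoutz a b; exists (u, v).
rewrite /= {1}aE {1}bE !mulrA -mulrDl -[RHS]mul1r => /(mulIf g_neq0) uv1.
have torsS : torsion (P *~ a' + Q *~ b').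
  by apply: (torsion_of_mulz g_neq0); rewrite mulrzDl -!mulrzA -aE -bE rel; apply: torsion0.
exists (P *~ v - Q *~ u), b', (- a'); split.
- by apply: contra_neq b_neq0; rewrite bE => ->; rewrite mul0r.
- by rewrite oppr_eq0; apply: contra_neq a_neq0; rewrite aE => ->; rewrite mul0r.
- by apply/coprimezP; exists (v, - u); rewrite /= mulrNN addrC.
exists ((P *~ a' + Q *~ b') *~ u), ((P *~ a' + Q *~ b') *~ v).
split; [exact: torsionMz | exact: torsionMz | | ].
- rewrite mulrzBl mulrzDl -!mulrzA addrACA -mulrzDr -mulrNz -mulrzDr.
  have -> : v * b' + a' * u = 1 by rewrite -uv1; ring.
  have -> : - (u * b') + b' * u = 0 by ring.
  by rewrite mulr0z addr0.
- rewrite mulrzBl mulrzDl -!mulrzA addrACA -mulrzDr -mulrNz -mulrzDr.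
  have -> : - (u * - a') + b' * v = 1 by rewrite -uv1; ring.
  have -> : v * - a' + a' * v = 0 by ring.
  by rewrite mulr0z add0r.
Qed.

Lemma dependent_local_to_global (P Q R TP TQ : B) (m n : int) :
  ~ torsion R -> m != 0 -> n != 0 -> coprimez m n -> torsion TP -> torsion TQ ->
  P = R *~ m + TP -> Q = R *~ n + TQ ->
  almost_all (fun v : nfprime F => exists x y : int, coprimez x y /\
      exists2 T : B, torsion T & r v (P *~ (x ^+ 2) + Q *~ (y ^+ 2)) = r v T) ->
  exists x y : int, coprimez x y /\
      exists2 T : B, torsion T & P *~ (x ^+ 2) + Q *~ (y ^+ 2) = T.
Proof.
move=> hR m_neq0 n_neq0 cop torsP torsQ P_eq Q_eq [l loc].
have [N N_gt0 killN] := torsion_exponent.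
have combE (x y : int) : P *~ (x ^+ 2) + Q *~ (y ^+ 2) =
    R *~ (x ^+ 2 * m + y ^+ 2 * n) + (TP *~ (x ^+ 2) + TQ *~ (y ^+ 2)).
  by rewrite P_eq Q_eq !mulrzDl addrACA -!mulrzA -mulrzDr ![m * _]mulrC ![n * _]mulrC.
have torsC (x y : int) : torsion (TP *~ (x ^+ 2) + TQ *~ (y ^+ 2)).
  by apply: torsionD; apply: torsionMz.
have [//|x [y [cop_xy sum0]]] := local_global_diagonal m_neq0 n_neq0 cop.
  move=> p k p_pr.
  (* [logn p N] compensates for the torsion; the successor keeps the exponent positive, so that (A1)
     always prescribes a divisibility here. *)
  have [|S [densS ordS]] := @hA1 p p_pr 1%N (fun=> (k + logn p N).+1) (fun=> R).
    move=> a; rewrite big_ord1 => Ra0 i; rewrite (ord1 i); apply/eqP.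
    apply/negP => /negP a_neq0; apply: hR; apply: (torsion_of_mulz a_neq0).
    by rewrite Ra0; apply: torsion0.
  have [v [Sv /loc[x [y [cop_xy [T torsT eq_v]]]]]] := pos_density_avoids l densS.
  exists x, y; split=> //; have [dvdR _] := ordS v Sv ord0.
  rewrite dvdzE /=; apply: (pfactor_dvd_mul p_pr N_gt0).
  apply: dvdn_trans (dvdn_trans (dvdn_exp2l p (leqnSn _)) dvdR) _.
  apply: (ord_v_dvd_of_torsion killN (torsionD torsT (torsionN (torsC x y)))).
  by rewrite raddfB -eq_v combE raddfD addrK.
exists x, y; split=> //; exists (TP *~ (x ^+ 2) + TQ *~ (y ^+ 2)) => //.
by rewrite combE sum0 mulr0z add0r.
Qed.

End LocalToGlobal.

Theorem theorem2p1 (F : fieldExtType rat) (B : zmodType) (Bv : nfprime F -> finZmodType)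
  (r : forall v, {additive B -> Bv v})
  (hA1 : assumptionA1 r) (hA2 : assumptionA2 r)
  (P Q : B) (hP : ~ torsion P) (hQ : ~ torsion Q) :
  almost_all (fun v : nfprime F => exists x y : int, coprimez x y /\
      exists2 T : B, torsion T & r v (P *~ (x ^+ 2) + Q *~ (y ^+ 2)) = r v T)
  <->
  (exists x y : int, coprimez x y /\
      exists2 T : B, torsion T & P *~ (x ^+ 2) + Q *~ (y ^+ 2) = T).
Proof.
split; last first.
  move=> [x [y [cop [T torsT eq_T]]]]; exists [::] => v _.
  by exists x, y; split=> //; exists T; rewrite // eq_T.
(* For independent points (i) is contradictory, so a solution is constructed only in the dependent
   case. *)
have [indep|] := EM (forall a b : int, P *~ a + Q *~ b = 0 -> a = 0 /\ b = 0).
  by move/(independent_not_locally_solvable hA1 hA2 indep).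
move=> /existsNP[a /existsNP[b /not_implyP[rel ab_neq0]]].
have [R [m [n [m_neq0 n_neq0 cop [TP [TQ [torsP torsQ P_eq Q_eq]]]]]]] :=
  dependent_common_divisor hP hQ rel ab_neq0.
have hR : ~ torsion R.
  by move=> torsR; apply: hP; rewrite P_eq; apply: torsionD => //; apply: torsionMz.
exact: (dependent_local_to_global hA1 hA2 hR m_neq0 n_neq0 cop torsP torsQ P_eq Q_eq).
Qed.
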